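(* Let $A$ be a bounded operator on an infinite dimensional complex Hilbert space $\mathcal{H}$. Assume the invariant subspace problem for Hilbert space operators has a positive solution. Then there is a maximal nest in $\mathcal{H}$ with respect to which $A$ is upper triangular.
   Context: A positive solution to the invariant subspace problem for Hilbert space operators means: every bounded operator on a complex Hilbert space $\mathcal{K}$ of dimension greater than $1$ has an invariant closed subspace other than $\{0\}$ and $\mathcal{K}$. A nest in $\mathcal{H}$ is a family of closed subspaces totally ordered by inclusion; it is maximal if it is not properly contained in any other nest. $A$ is upper triangular with respect to a nest if $A(\mathcal{E})\subseteq\mathcal{E}$ for each subspace $\mathcal{E}$ in the nest. *)

(* Defs.v *)
From HB Require Import structures.
From mathcomp Require Import all_boot all_order all_algebra.
From mathcomp Require Import all_real_closed.
From mathcomp Require Import all_classical all_reals all_analysis.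

Set Implicit Arguments.
Unset Strict Implicit.
Unset Printing Implicit Defensive.

Import Order.TTheory GRing.Theory Num.Theory.
Import numFieldNormedType.Exports.

Local Open Scope classical_set_scope.
Local Open Scope ring_scope.

(** The real numbers are an arbitrary [R : realType] and the complex numbers
    are [R[i]].  The norm of a [normedModType R[i]] takes its values in [R[i]],
    whose order satisfies [x <= y] iff [y - x] is a nonnegative real.  The inner
    product is linear in its first argument and conjugate-linear in the second. *)

HB.mixin Record isHilbert (R : realType) H & CompleteNormedModule R[i] H := {
  inner : {dot H for @Num.conj R[i]} ;
  inner_norm : forall x : H, `|x| ^+ 2 = inner x x
}.

#[short(type="hilbertType")]
HB.structure Definition Hilbert (R : realType) :=
  {H of CompleteNormedModule R[i] H & isHilbert R H}.

Definition lin_indep (K : numFieldType) (V : lmodType K) (n : nat)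
    (e : 'I_n -> V) : Prop :=
  forall c : 'I_n -> K, \sum_i c i *: e i = 0 -> forall i, c i = 0.

Definition dim_ge (K : numFieldType) (V : lmodType K) (n : nat) : Prop :=
  exists e : 'I_n -> V, lin_indep e.

Definition infinite_dim (K : numFieldType) (V : lmodType K) : Prop :=
  forall n, dim_ge V n.

Definition bounded_operator (K : numFieldType) (V : normedModType K)
    (A : {linear V -> V}) : Prop :=
  exists M : K, forall x, `|A x| <= M * `|x|.

Definition closed_subspace (K : numFieldType) (V : normedModType K)
    (E : set V) : Prop :=
  submod_closed [in E] /\ closed E.

Definition invariant_under (V : Type) (A : V -> V) (E : set V) : Prop :=
  A @` E `<=` E.

Definition invariant_subspace_property (R : realType) : Prop :=
  forall (K : hilbertType R) (A : {linear K -> K}),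
    dim_ge K 2 -> bounded_operator A ->
    exists E : set K, [/\ closed_subspace E, invariant_under A E,
                          E <> [set 0] & E <> [set: K]].

Definition nest (K : numFieldType) (V : normedModType K)
    (N : set (set V)) : Prop :=
  N `<=` @closed_subspace K V /\ total_on N subset.

Definition maximal_nest (K : numFieldType) (V : normedModType K)
    (N : set (set V)) : Prop :=
  nest N /\ forall N' : set (set V), nest N' -> ~ (N `<` N').

Definition upper_triangular (V : Type) (A : V -> V) (N : set (set V)) : Prop :=
  forall E, N E -> invariant_under A E.

(* Main.v *)
(** By Zorn's lemma there is a nest [N] maximal among the nests of closed
    [A]-invariant subspaces.  If some nest strictly larger than [N] contained a
    new subspace [F], let [G] be the closed span of the members of [N] below
    [F] and [E] the intersection of those above [F]; both are in [N], so
    [G < F < E], and the orthogonal complement of [G] in [E] has dimension at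
    least 2.  An invariant subspace of the compression of [A] to this
    complement, added to [G], is an [A]-invariant subspace strictly between [G]
    and [E] that is comparable to all of [N], hence is in [N]; being also
    comparable to [F], it is below [G] or above [E], a contradiction. *)

Require Import Defs.
From HB Require Import structures.
From mathcomp Require Import all_boot all_order all_algebra.
From mathcomp Require Import all_real_closed.
From mathcomp Require Import all_classical all_reals all_analysis.
From mathcomp Require Import ring lra.

Set Implicit Arguments.
Unset Strict Implicit.
Unset Printing Implicit Defensive.

Import Order.TTheory GRing.Theory Num.Theory.
Import numFieldNormedType.Exports.

Local Open Scope classical_set_scope.
Local Open Scope ring_scope.

(** * Closed subspaces and bounded operators *)

Section ClosedSubspace.
Context {K : numFieldType} {V : normedModType K} {E : set V}.
Hypothesis hE : closed_subspace E.

Lemma closed_subspace0 : E 0.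
Proof. exact: set_mem hE.1.1. Qed.

Lemma closed_subspaceP a x y : E x -> E y -> E (a *: x + y).
Proof. by move=> Ex Ey; apply/set_mem/hE.1.2; exact: mem_set. Qed.

Lemma closed_subspaceZ a x : E x -> E (a *: x).
Proof.
by move=> Ex; rewrite -[_ *: _]addr0; apply: closed_subspaceP closed_subspace0.
Qed.

Lemma closed_subspaceD x y : E x -> E y -> E (x + y).
Proof. by rewrite -{2}[x]scale1r; exact: closed_subspaceP. Qed.

Lemma closed_subspaceB x y : E x -> E y -> E (x - y).
Proof.
by move=> Ex Ey; rewrite -scaleN1r addrC; exact: closed_subspaceP.
Qed.

End ClosedSubspace.

Lemma closed_subspace_bigI (K : numFieldType) (V : normedModType K) (I : Type)
    (D : set I) (E : I -> set V) :
  (forall i, D i -> closed_subspace (E i)) ->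
  closed_subspace (\bigcap_(i in D) E i).
Proof.
move=> hE; split; last by apply: closed_bigI => i /hE[].
split; first by apply/mem_set => i /hE; exact: closed_subspace0.
move=> a x y /set_mem Ex /set_mem Ey; apply/mem_set => i Di.
by apply: closed_subspaceP (hE i Di) _ _ _ _ _; [exact: Ex | exact: Ey].
Qed.

Lemma closed_subspaceI (K : numFieldType) (V : normedModType K) (E F : set V) :
  closed_subspace E -> closed_subspace F -> closed_subspace (E `&` F).
Proof.
move=> hE hF; split; last exact: closedI hE.2 hF.2.
split; first by apply/mem_set; split; exact: closed_subspace0.
move=> a x y /set_mem[Ex Fx] /set_mem[Ey Fy].
by apply/mem_set; split; exact: closed_subspaceP.
Qed.

(** On the zero space the bound [M] may be negative or not real. Its absolute value always works,
    since [M * |x|] dominates a norm and so is nonnegative. *)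
Lemma bounded_operator_ge0 (K : numFieldType) (V : normedModType K)
    (f : {linear V -> V}) : bounded_operator f ->
  exists2 M : K, 0 <= M & forall x, `|f x| <= M * `|x|.
Proof.
move=> [M fM]; exists `|M| => // x; apply: le_trans (fM x) _.
by rewrite -(ger0_norm (le_trans (normr_ge0 _) (fM x))) normrM normr_id.
Qed.

Lemma bounded_operator_comp (K : numFieldType) (V : normedModType K)
    (f g : {linear V -> V}) :
  bounded_operator f -> bounded_operator g -> bounded_operator (f \o g).
Proof.
move=> /bounded_operator_ge0 [M M0 fM] [N gN]; exists (M * N) => x /=.
by rewrite -mulrA (le_trans (fM _))// ler_wpM2l.
Qed.

Lemma bounded_operator_sub_id (K : numFieldType) (V : normedModType K)
    (f : {linear V -> V}) :
  bounded_operator f -> bounded_operator (idfun \- f).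
Proof.
move=> [M fM]; exists (1 + M) => x /=.
by rewrite mulrDl mul1r (le_trans (ler_normB _ _))// lerD2l.
Qed.

Lemma closed_subspace_set0 (K : numFieldType) (V : normedModType K) :
  closed_subspace [set (0 : V)].
Proof.
split; last first.
  exact/accessible_closed_set1/hausdorff_accessible/norm_hausdorff.
split=> [|a x y]; first exact/mem_set.
by move=> /set_mem -> /set_mem ->; apply/mem_set; rewrite scaler0 addr0.
Qed.

Lemma bounded_operator_continuous (K : numFieldType) (V : normedModType K)
    (f : {linear V -> V}) : bounded_operator f -> continuous f.
Proof.
move=> /bounded_operator_ge0 [M M0 fM].
apply/bounded_linear_continuous/linear_boundedP.
exists M; split=> [|r /ltW Mr x]; first exact: ger0_real.
by rewrite (le_trans (fM x))// ler_wpM2r.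
Qed.

Lemma closed_subspace_preimage (K : numFieldType) (V : normedModType K)
    (f : {linear V -> V}) (E : set V) :
  bounded_operator f -> closed_subspace E -> closed_subspace (f @^-1` E).
Proof.
move=> fb hE; split.
  split; first by apply/mem_set; rewrite /= raddf0; exact: closed_subspace0.
  move=> a x y /set_mem Ex /set_mem Ey; apply/mem_set; rewrite /= linearP.
  exact: closed_subspaceP.
by apply: preimage_closed hE.2 => x _; exact: bounded_operator_continuous.
Qed.

(** * A closed subspace as a Hilbert space *)

Section SubHilbert.
Context {R : realType} {H : hilbertType R} {E : set H} (hE : closed_subspace E).

(** The closedness proof is a parameter of the type, so that the instances declared on it can depend
    on that proof. *)
Definition sub_hilbert of closed_subspace E : Type := {x : H | x \in E}.
Local Notation K := (sub_hilbert hE).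

HB.instance Definition _ := SubChoice.copy K {x : H | x \in E}.
HB.instance Definition _ := GRing.SubChoice_isSubLmodule.Build _ _ _ K hE.1.

Let norm (x : K) : R[i] := `|val x|.
Let ler_normD (x y : K) : norm (x + y) <= norm x + norm y.
Proof. by rewrite /norm raddfD; exact: ler_normD. Qed.
Let normrZ (l : R[i]) (x : K) : norm (l *: x) = `|l| * norm x.
Proof. by rewrite /norm linearZ /= normrZ. Qed.
Let normr0_eq0 (x : K) : norm x = 0 -> x = 0.
Proof. by move/normr0_eq0 => x0; apply: val_inj; rewrite x0 raddf0. Qed.

HB.instance Definition _ :=
  Lmodule_isNormed.Build R[i] K ler_normD normrZ normr0_eq0.

Let cauchy_cvg (F : set_system K) : ProperFilter F -> cauchy F -> cvg F.
Proof.
move=> FF Fc.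
(* The image filter is Cauchy because the norm is the restricted one; its limit in [H] stays in the
   closed set [E]. *)
have cG : cauchy ((val : K -> H) @ F).
  apply/cauchy_ballP => e e0.
  have /cauchy_ballP /(_ e e0) := Fc.
  move=> [[A B]] /= [FA FB] AB; exists (val @` A, val @` B) => /=.
    by split; [apply: filterS FA | apply: filterS FB] => x Ax; exists x.
  move=> [_ _] /= [[x Ax <-] [y By <-]]; have := AB (x, y) (conj Ax By).
  by rewrite -!ball_normE.
have /cvg_ex [l Fl] : cvg ((val : K -> H) @ F) by exact: cauchy_cvg.
have lE : l \in E.
  rewrite inE; apply: (closed_cvg E hE.2 _ _ Fl).
  by apply: nearW => x; rewrite -[E _]inE; exact: valP.
apply/cvg_ex; exists (Sub l lE : K); apply/cvgrPdist_lt => e e0.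
by move/cvgrPdist_lt : Fl => /(_ e e0).
Qed.
HB.instance Definition _ := Uniform_isComplete.Build K cauchy_cvg.

Let dot (x y : K) : R[i] := inner (val x) (val y).
Let dot_bilin : bilinear_for *%R (Num.conj \; *%R) dot.
Proof.
split=> [u a x y|u a x y]; rewrite /dot.
  by rewrite [val (_ + _)]linearP linearPl.
by rewrite [val (_ + _)]linearP linearPr.
Qed.
HB.instance Definition _ :=
  bilinear_isBilinear.Build R[i] K K R[i] _ _ dot dot_bilin.

Let dot_herm (x y : K) : dot x y = (-1) ^+ false * Num.conj (dot y x).
Proof. exact: hermC. Qed.
HB.instance Definition _ :=
  isHermitianSesquilinear.Build R[i] K false Num.conj dot dot_herm.

Let dot_gt0 (x : K) : x != 0 -> 0 < dot x x.
Proof.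
move=> x0; apply: neq0_dnorm_gt0; apply: contra x0 => /eqP x0.
by apply/eqP/val_inj; rewrite x0 raddf0.
Qed.
HB.instance Definition _ := isDotProduct.Build R[i] K dot dot_gt0.

Let dot_norm (x : K) : `|x| ^+ 2 = dot x x.
Proof. exact: inner_norm. Qed.
HB.instance Definition _ := isHilbert.Build R K dot_norm.

(** A closure point of the image lies in [E], as [E] is closed, and there it is a closure point of
    [M] because the balls of the subspace are traces of those of [H]. *)
Lemma closed_subspace_val_image (M : set K) :
  closed_subspace M -> closed_subspace (val @` M).
Proof.
move=> hM; split.
  split.
    apply/mem_set; exists 0; [exact: closed_subspace0 | exact: raddf0].
  move=> a _ _ /set_mem [x Mx <-] /set_mem [y My <-]; apply/mem_set.
  by exists (a *: x + y); [exact: closed_subspaceP | exact: linearP].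
move=> y cly.
have yE : y \in E.
  apply/mem_set/hE.2; apply: closureS cly => _ [x _ <-].
  exact: set_mem (valP x).
exists (Sub y yE : K); last exact: SubK.
apply: hM.2 => B /nbhs_ballP [e e0 eB].
have [_ [[x Mx <-] xe]] := cly _ (nbhsx_ballx y e e0).
by exists x; split=> //; apply: eB; move: xe; rewrite -!ball_normE.
Qed.

End SubHilbert.

(** * Orthogonal projection onto a closed subspace *)

Section OrthogonalProjection.
Context {R : realType} {H : hilbertType R}.
Implicit Types (x y z w : H) (E : set H).

(** A real-valued copy of the norm gives access to infima and to real arithmetic. *)
Let nrm x : R := complex.Re `|x|.

Let nrmE x : `|x| = (nrm x)%:C%C.
Proof. by rewrite RRe_real ?normr_real. Qed.

Let ler_nrm x y : (nrm x <= nrm y) = (`|x| <= `|y|).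
Proof. by rewrite !nrmE lecR. Qed.

Let nrm_ge0 x : 0 <= nrm x.
Proof. by rewrite -ler0c -nrmE. Qed.

Let nrmD x y : nrm (x + y) <= nrm x + nrm y.
Proof. by rewrite -lecR rmorphD /= -!nrmE ler_normD. Qed.

Let innerBl x y z : inner (x - y) z = inner x z - inner y z.
Proof. exact: linearBl. Qed.

Let innerPl (a : R[i]) x y z : inner (a *: x + y) z = a * inner x z + inner y z.
Proof. exact: linearPl. Qed.

Lemma parallelogram x y :
  `|x + y| ^+ 2 + `|x - y| ^+ 2 = (`|x| ^+ 2 + `|y| ^+ 2) *+ 2.
Proof. by rewrite !inner_norm dnormD dnormB addrACA subrr addr0 mulr2n. Qed.

(* Makes any two almost nearest points of a subspace close to each other, since
   their midpoint [m] also lies in the subspace. *)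
Let nrm_midpoint x y z (m := 2^-1 *: (y + z)) :
  nrm (y - z) ^+ 2 + (nrm (x - m) ^+ 2) *+ 4 =
  (nrm (x - y) ^+ 2 + nrm (x - z) ^+ 2) *+ 2.
Proof.
apply: complexI.
rewrite rmorphD !rmorphMn rmorphD !rmorphXn /= -!nrmE -parallelogram addrC.
have -> : x - y + (x - z) = 2 *: (x - m).
  rewrite scalerBr scalerA divff ?pnatr_eq0// scale1r scaler_nat mulr2n.
  by rewrite opprD addrACA.
have -> : x - y - (x - z) = z - y by rewrite opprB addrC addrA subrK.
by rewrite normrZ exprMn normr_nat -natrX mulr_natl (distrC z).
Qed.

Lemma orthogonal_of_min_norm (w e : H) :
  (forall a : R[i], `|w| <= `|w + a *: e|) -> inner w e = 0.
Proof.
move=> wmin; have [->|e0] := eqVneq e 0; first by rewrite linear0r.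
have n0 : 0 < inner e e by exact: neq0_dnorm_gt0.
have nC : (inner e e)^* = inner e e by apply: conj_Creal; exact: gtr0_real.
(* The optimal coefficient: [w + a *: e] is then orthogonal to [e]. *)
have := wmin (- (inner w e / inner e e)).
rewrite scaleNr -(ler_pXn2r (n := 2)) ?nnegrE// !inner_norm dnormB dnormZ.
rewrite linearZr_LR /=; set d := inner w e; set n := inner e e in n0 nC *.
(* The cross terms and the new square are all [|d| ^+ 2 / n], so the squared norm drops by exactly
   this amount, which minimality forces to be 0. *)
have -> : (d / n)^* * d = `|d| ^+ 2 / n.
  by rewrite rmorphM fmorphV /= nC mulrAC -normCKC.
have -> : `|d / n| ^+ 2 * n = `|d| ^+ 2 / n.
  by rewrite normf_div (gtr0_norm n0); field; rewrite gt_eqF.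
have c0 : 0 <= `|d| ^+ 2 / n by rewrite divr_ge0 ?exprn_ge0// ltW.
rewrite (conj_Creal (ger0_real c0)) opprD addrACA subrr addr0.
rewrite -subr_ge0 addrAC subrr add0r oppr_ge0 => c0'.
have /eqP := le_anti (introT andP (conj c0' c0)).
by rewrite mulf_eq0 invr_eq0 (gt_eqF n0) orbF expf_eq0 normr_eq0 => /eqP.
Qed.

(** The sets [B r] of almost nearest points generate a Cauchy filter, which plays the role of a
    minimizing sequence; its limit is the nearest point. *)
Lemma ex_nearest_point E x : closed_subspace E ->
  exists2 p, E p & forall e, E e -> `|x - p| <= `|x - e|.
Proof.
move=> hE; have E0 := closed_subspace0 hE.
pose D := [set nrm (x - e) | e in E].
have Dlb : lbound D 0 by move=> _ [e Ee <-]; exact: nrm_ge0.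
have Dinf : has_inf D by split; [exists (nrm (x - 0)); exists 0 | exists 0].
pose d := inf D.
have d0 : 0 <= d by apply: lb_le_inf => //; case: Dinf.
have dE e : E e -> d <= nrm (x - e).
  by move=> Ee; apply: ge_inf; [exists 0 | exists e].
pose B (r : R) := [set e | E e /\ nrm (x - e) < d + r].
pose F := filter_from [set r : R | 0 < r] B.
have FF : ProperFilter F.
  apply: filter_from_proper => [|r r0]; last first.
    by have [_ [e Ee <-] er] := inf_adherent r0 Dinf; exists e.
  apply: filter_from_filter; first by exists 1 => /=.
  move=> r s /= r0 s0; exists (Num.min r s); first by rewrite lt_min r0.
  move=> e [Ee]; rewrite -ltrBlDl lt_min => /andP[er es].
  by split; split; rewrite // -ltrBlDl.
have FB r : 0 < r -> F (B r) by exists r.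
(* The midpoint is at distance at least [d] from [x], so the bound is
   [4 * ((d + r) ^+ 2 - d ^+ 2)]. *)
have BB r y z : 0 < r -> B r y -> B r z ->
    nrm (y - z) ^+ 2 <= 4 * (2 * d * r + r ^+ 2).
  move=> r0 [Ey yr] [Ez zr].
  have := nrm_midpoint x y z => /=.
  have := dE _ (closed_subspaceZ hE 2^-1 (closed_subspaceD hE Ey Ez)).
  move: yr zr (dE _ Ey) (dE _ Ez).
  set m := nrm (x - _ *: _).
  move: m (nrm (x - y)) (nrm (x - z)) (nrm (y - z)) => m a b c ar br ad bd md.
  have sq (u v : R) : 0 <= u -> u <= v -> u ^+ 2 <= v ^+ 2.
    by move=> u0 uv; apply: lerXn2r; rewrite // nnegrE (le_trans u0).
  move: (sq _ _ (le_trans d0 ad) (ltW ar)) (sq _ _ (le_trans d0 bd) (ltW br)).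
  move: (sq _ _ d0 md) => {ar br ad bd md}.
  by move: (a ^+ 2) (b ^+ 2) (c ^+ 2) (m ^+ 2) => *; nra.
have Fc : cauchy F.
  apply: cauchy_exP => e0 e0_gt0.
  have [e [-> e_gt0]] : exists e : R, e0 = e%:C%C /\ 0 < e.
    exists (complex.Re e0); rewrite -ltcR !RRe_real ?gtr0_real //.
  (* As [r <= 1], the bound of [BB] is at most [(8 * d + 4) * r], which is below
     [(8 * d + 8) * r <= e ^+ 2]. *)
  pose r := Num.min 1 (e ^+ 2 / (8 * d + 8)).
  have r_gt0 : 0 < r.
    by rewrite lt_min ltr01 divr_gt0 ?exprn_gt0// ltr_wpDl// mulr_ge0.
  have [y By] := filter_ex (FB _ r_gt0).
  exists y; exists r => // z Bz; rewrite -ball_normE /= nrmE ltcR.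
  rewrite -(ltr_pXn2r (n := 2)) ?nnegrE ?nrm_ge0 ?ltW//.
  apply: le_lt_trans (BB _ _ _ r_gt0 By Bz) _.
  have : r <= 1 by rewrite ge_min lexx.
  have : r * (8 * d + 8) <= e ^+ 2.
    by rewrite -ler_pdivlMr ?ge_min ?lexx ?orbT// ltr_wpDl// mulr_ge0.
  by have := exprn_gt0 2 e_gt0; move: (e ^+ 2) => *; nra.
have /cvg_ex [p Fp] : cvg F by exact: cauchy_cvg.
exists p.
  have FE : \forall e \near F, E e by apply: filterS (FB 1 ltr01) => e [].
  exact: (closed_cvg E hE.2 FE _ Fp).
move=> e Ee; rewrite -ler_nrm; apply: le_trans (dE _ Ee).
apply/ler_addgt0Pr => r r0.
have r20 : 0 < r / 2 by rewrite divr_gt0.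
have /fcvgrPdist_lt /(_ (r / 2)%:C%C) := Fp.
rewrite ltcR => /(_ r20) [s s0 Bs].
have [y [[Ey ys] [_ yr]]] := filter_ex (filterI (FB _ s0) (FB _ r20)).
have := Bs y (conj Ey ys); rewrite /= distrC nrmE ltcR => yp.
rewrite (le_trans (_ : _ <= nrm (x - y) + nrm (y - p))) //.
  by rewrite -[x - p](subrKA y) nrmD.
by move: yr yp; lra.
Qed.

Lemma ex_orthogonal_decomposition E x : closed_subspace E ->
  exists2 p, E p & forall e, E e -> inner (x - p) e = 0.
Proof.
move=> hE; have [p Ep pmin] := ex_nearest_point x hE.
exists p => // e Ee; apply: orthogonal_of_min_norm => a.
have -> : x - p + a *: e = x - (p - a *: e) by rewrite opprB addrA addrAC.
by apply/pmin/closed_subspaceB/closed_subspaceZ.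
Qed.

(** Linearity follows from the uniqueness of the decomposition, and the bound 1 from Pythagoras. *)
Lemma ex_orthogonal_projection E : closed_subspace E ->
  exists P : {linear H -> H},
    [/\ forall x, E (P x), forall x, E x -> P x = x & bounded_operator P].
Proof.
move=> hE.
pose p x := s2val (cid2 (ex_orthogonal_decomposition x hE)).
have Ep x : E (p x) := s2valP (cid2 (ex_orthogonal_decomposition x hE)).
have po x e : E e -> inner (x - p x) e = 0.
  exact: s2valP' (cid2 (ex_orthogonal_decomposition x hE)) e.
have uniq_p x y : E y -> (forall e, E e -> inner (x - y) e = 0) -> p x = y.
  (* The vector [p x - y] lies in [E] and is a difference of two vectors orthogonal to [E], so it is
     orthogonal to itself. *)
  move=> Ey yo; apply/eqP; rewrite -subr_eq0 -(dnorm_eq0 inner); apply/eqP.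
  have Epy : E (p x - y) by exact: closed_subspaceB.
  have -> : inner (p x - y) (p x - y) =
      inner (x - y) (p x - y) - inner (x - p x) (p x - y).
    by rewrite -innerBl [x - y - _]addrC opprB addrA subrK.
  by rewrite yo // po // subr0.
have p_linear : linear p.
  move=> a x y; apply: uniq_p; first exact: closed_subspaceP.
  move=> e Ee; rewrite opprD addrACA -scalerBr innerPl !po //.
  by rewrite mulr0 addr0.
pose P : {linear H -> H} :=
  HB.pack p (GRing.isLinear.Build R[i] H H *:%R p p_linear).
exists P; split=> [x|x Ex|]; first exact: Ep.
  by apply: uniq_p => // e _; rewrite subrr linear0l.
exists 1 => x; rewrite mul1r -(ler_pXn2r (n := 2)) ?nnegrE// !inner_norm.
have -> : inner x x = inner (x - p x) (x - p x) + inner (p x) (p x).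
  by rewrite -(hnormDd (po x _ (Ep x))) subrK.
by rewrite lerDr dnorm_ge0.
Qed.

End OrthogonalProjection.

(** * Invariant subspaces between two given ones *)

Lemma dim_ge2_notin (K : numFieldType) (V : lmodType K) (F : set V) (u v : V) :
  (forall a x, F x -> F (a *: x)) -> F u -> u != 0 -> ~ F v -> dim_ge V 2.
Proof.
move=> FZ Fu u0 Fv; exists (fun i => if i == 0 then u else v) => c.
rewrite big_ord_recl big_ord1 /= => cuv.
have c1 : c (lift ord0 ord0) = 0.
  apply/eqP; apply: contra_notT Fv => c1.
  have -> : v = - ((c (lift ord0 ord0))^-1 * c ord0) *: u.
    rewrite scaleNr -scalerA -scalerN (_ : - _ = c (lift ord0 ord0) *: v).
      by rewrite scalerA mulVf // scale1r.
    by apply/eqP; rewrite eq_sym -addr_eq0 addrC cuv.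
  exact: FZ.
have c0 : c ord0 = 0.
  by move/eqP: cuv; rewrite c1 scale0r addr0 scaler_eq0 (negPf u0) orbF => /eqP.
by move=> i; case: (unliftP ord0 i) => [j|] -> //; rewrite ord1.
Qed.

(** The subspace [F], which need not be invariant, guarantees that the complement of [G] in [E] has
    dimension at least 2. *)
Lemma ex_invariant_between (R : realType) (H : hilbertType R)
    (A : {linear H -> H}) (G F E : set H) :
  invariant_subspace_property R -> bounded_operator A ->
  closed_subspace G -> closed_subspace F -> closed_subspace E ->
  invariant_under A G -> invariant_under A E -> G `<` F -> F `<` E ->
  exists L, [/\ closed_subspace L, invariant_under A L, G `<` L & L `<` E].
Proof.
move=> isp bA hG hF hE AG AE [GsubF /nonsubset [f [Ff nGf]]] [FsubE FneE].
have {FneE} [e [Ee nFe]] := nonsubset FneE.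
have GsubE : G `<=` E by exact: subset_trans FsubE.
have [P [PG PK bP]] := ex_orthogonal_projection hG.
(* [q] projects onto the complement [C] of [G] in [E]; the subspace sought is
   [G + M], written as [E `&` q @^-1` M]. *)
pose q : {linear H -> H} := idfun \- P.
have bq : bounded_operator q by exact: bounded_operator_sub_id.
have q0 x : G x -> q x = 0 by move=> Gx; rewrite /q /= PK// subrr.
pose C := E `&` P @^-1` [set 0].
have hC : closed_subspace C.
  apply: closed_subspaceI => //; apply: closed_subspace_preimage => //.
  exact: closed_subspace_set0.
have qC x : E x -> C (q x).
  move=> Ex; split; first by apply: closed_subspaceB => //; exact: GsubE.
  by rewrite /q /= raddfB /= [P (P x)]PK// subrr.
have q_id x : C x -> q x = x by move=> [_ /= Px]; rewrite /q /= Px subr0.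
have CK (k : sub_hilbert hC) : C (val k) by exact: set_mem (valP k).
have qAC (k : sub_hilbert hC) : q (A (val k)) \in C.
  by apply/mem_set/qC/AE; exists (val k) => //; case: (CK k).
pose b (k : sub_hilbert hC) : sub_hilbert hC := Sub (q (A (val k))) (qAC k).
have b_linear : linear b.
  move=> a x y; apply: val_inj; rewrite [RHS]linearP !SubK.
  by rewrite !linearP.
pose B : {linear sub_hilbert hC -> sub_hilbert hC} :=
  HB.pack b (GRing.isLinear.Build R[i] (sub_hilbert hC) (sub_hilbert hC)
    *:%R b b_linear).
have bB : bounded_operator B.
  by have [M qAM] := bounded_operator_comp bq bA; exists M => k; exact: qAM.
have dimK : dim_ge (sub_hilbert hC) 2.
  (* The set [F] separates [q f] from [q e]: both [f] and [P f] lie in [F], whereas [e] is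
     [q e + P e] with [P e] in [F] and [e] outside. *)
  have qf0 : q f != 0.
    rewrite /q /= subr_eq0; apply: contra_notN nGf => /eqP ->; exact: PG.
  pose u : sub_hilbert hC := Sub (q f) (mem_set (qC f (FsubE f Ff))).
  pose v : sub_hilbert hC := Sub (q e) (mem_set (qC e Ee)).
  apply: (@dim_ge2_notin _ _ (val @^-1` F) u v) => [a x Fx|||].
  - by rewrite /preimage /mkset linearZ; exact: closed_subspaceZ.
  - by rewrite /=; apply: closed_subspaceB => //; exact: GsubF.
  - apply: contra qf0 => /eqP /(congr1 val); rewrite raddf0 => u0.
    exact/eqP.
  - rewrite /= => Fqe; apply: nFe; rewrite -[e](subrK (P e)).
    by apply: closed_subspaceD => //; exact: GsubF.
have [M [hM BM M0 MT]] := isp _ B dimK bB.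
exists (E `&` q @^-1` (val @` M)); split.
- apply: closed_subspaceI => //; apply: closed_subspace_preimage => //.
  exact: closed_subspace_val_image.
- move=> _ [x [Ex [m Mm qx]] <-]; split; first by apply: AE; exists x.
  exists (B m); first by apply: BM; exists m.
  (* Split [x] as [q x + P x]: the first term is [B m], and the second vanishes because [A] keeps
     [P x] in [G], which [q] kills. *)
  have -> : q (A x) = q (A (q x)) + q (A (P x)).
    by rewrite -!raddfD [q x + _]subrK.
  rewrite [q (A (P x))]q0 ?addr0 -?qx //.
  by apply: AG; exists (P x).
- split=> [x Gx|].
    split; first exact: GsubE.
    by exists 0; [exact: closed_subspace0 | rewrite q0 // raddf0].
  (* Each [val m] lies in the new subspace; if that were inside [G], [q] would both fix and kill
     [val m]. *)
  apply: contra_not M0 => LG; apply/seteqP; split=> [m Mm|_ ->] /=; last first.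
    exact: closed_subspace0.
  have [Em _] := CK m; apply: val_inj.
  have <- : q (val m) = val m by apply: q_id.
  rewrite raddf0; apply/q0/LG; split=> //.
  by exists m => //; rewrite q_id.
- split=> [x [//]|EL]; apply: MT; apply/seteqP; split=> // k _.
  have [Ek _] := CK k; have [_ [m Mm]] := EL _ Ek.
  by rewrite q_id // => /val_inj <-.
Qed.

(** * Maximality among all nests *)

Theorem theorem8p4 (R : realType) (H : hilbertType R) (A : {linear H -> H}) :
  infinite_dim H ->
  bounded_operator A ->
  invariant_subspace_property R ->
  exists N : set (set H), maximal_nest N /\ upper_triangular A N.
Proof.
move=> _ bA isp.
have [N [[[Ncl Ntot] NA] Nmax]] : exists N : set (set H),
    (nest N /\ upper_triangular A N) /\
    forall N', N `<` N' -> ~ (nest N' /\ upper_triangular A N').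
  apply: Zorn_bigcup => /= T TP Ttot; split; last first.
    by move=> X [N /TP [_ NA] NX]; exact: NA.
  split=> [X [N /TP [[Ncl _] _] NX]|X Y [N TN NX] [N' TN' NY]].
    exact: Ncl.
  (* Two members of the union of a chain already lie in a common nest, the larger of their two. *)
  have [NN'|N'N] := Ttot _ _ TN TN'.
    by have [[_ tot] _] := TP _ TN'; apply: tot => //; exact: NN'.
  by have [[_ tot] _] := TP _ TN; apply: tot => //; exact: N'N.
have Nmem L : closed_subspace L -> invariant_under A L ->
    (forall X, N X -> X `<=` L \/ L `<=` X) -> N L.
  move=> hL AL NL; apply: contrapT => nNL; apply: (Nmax (N `|` [set L])).
    by split=> [X|/(_ L)] ; [left | move/(_ (or_intror erefl))].
  split; last by move=> X [/NA|->].
  split; first by move=> X [/Ncl|->].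
  move=> X Y [NX|->] [NY|->]; [exact: Ntot|exact: NL| |by left].
  by have [] := NL _ NY; [right | left].
exists N; split=> //; split=> // N' [N'cl N'tot] [NN' N'N].
have [F [N'F nNF]] := nonsubset N'N.
have hF := N'cl F N'F.
have Fcmp X : N X -> X `<=` F \/ F `<=` X.
  by move=> /NN' N'X; exact: N'tot.
(* The closed span is taken as an intersection; with no member below [F] it is [[set 0]]. Likewise
   [E] is the whole space if no member lies above [F]. *)
pose S := [set X | closed_subspace X /\ forall Y, N Y -> Y `<=` F -> Y `<=` X].
pose G := \bigcap_(X in S) X.
pose E := \bigcap_(X in [set X | N X /\ F `<=` X]) X.
have hG : closed_subspace G by apply: closed_subspace_bigI => X [].
have hE : closed_subspace E by apply: closed_subspace_bigI => X [/Ncl].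
have ltG X : N X -> X `<=` F -> X `<=` G.
  by move=> NX XF x Xx Y [_ /(_ X NX XF)]; exact.
have gtE X : N X -> F `<=` X -> E `<=` X by move=> NX FX x; apply.
have GF : G `<=` F by move=> x; apply; split.
have FE : F `<=` E by move=> x Fx X [_]; exact.
have AE : invariant_under A E.
  move=> _ [x Ex <-] X XF; have [NX FX] := XF; apply: (NA X NX).
  by exists x => //; exact: Ex.
have AG : invariant_under A G.
  (* The preimage of [G] is one of the closed subspaces intersected to form [G], so it contains
     [G]. *)
  have SA : S (A @^-1` G).
    split=> [|Y NY YF x Yx]; first exact: closed_subspace_preimage.
    by apply: (ltG Y) => //; apply: NA NY _ _; exists x.
  by move=> _ [x Gx <-]; exact: Gx SA.
have NG : N G.
  apply: Nmem => // X NX; have [XF|FX] := Fcmp X NX; [left|right].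
    exact: ltG.
  exact: subset_trans FX.
have NE : N E.
  apply: Nmem => // X NX; have [XF|FX] := Fcmp X NX; [left|right].
    exact: subset_trans FE.
  exact: gtE.
(* Equality would put [F] in [N]. *)
have GFprop : G `<` F.
  by split=> // FG; apply: nNF; rewrite (_ : F = G) //; apply/seteqP; split.
have FEprop : F `<` E.
  by split=> // EF; apply: nNF; rewrite (_ : F = E) //; apply/seteqP; split.
have [L [hL AL [GL nLG] [LE nEL]]] :=
  ex_invariant_between isp bA hG hF hE AG AE GFprop FEprop.
have NL : N L.
  apply: Nmem => // X NX; have [XF|FX] := Fcmp X NX; [left|right].
    by apply: subset_trans GL; exact: ltG.
  by apply: subset_trans LE _; exact: gtE.
have [LF|FL] := Fcmp L NL; [apply: nLG|apply: nEL]; [exact: ltG|exact: gtE].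
Qed.
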